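(* Let $\lambda\in\mathbb{C}\setminus\{0\}$ and let $f^n$ denote the $n$-th iterate of $f(z)=-2z^2$. (1) If $G_{f^n(\lambda)}$ is parabolic dust for some integer $n\ge 0$, then $G_\lambda$ is either parabolic dust or non-free. (2) If $G_{f^n(\lambda)}$ is non-free for some integer $n\ge 0$, then $G_\lambda$ is non-free.
   Context: For $\lambda\in\mathbb{C}\setminus\{0\}$, $G_\lambda=\langle S,T_\lambda\rangle$ is the subgroup of $PSL(2,\mathbb{C})$ generated by (the classes of) $S=\begin{pmatrix}1&0\\1&1\end{pmatrix}$ and $T_\lambda=\begin{pmatrix}1&2\lambda\\0&1\end{pmatrix}$. ''Non-free'' means that $G_\lambda$ is not a free group. $G_\lambda$ is not assumed discrete. If $G$ is a subgroup of $PSL(2,\mathbb{C})$, a parabolic element $h\in G$ is a primitive parabolic (of $G$) if $h=g^m$ with $g\in G$ and $m\in\mathbb{Z}$ implies $m=\pm1$. The group $G_\lambda$ (discrete or not) is called parabolic dust if it has a third conjugacy class of primitive parabolics, i.e. at least three conjugacy classes; here classes are counted as conjugacy classes in $G_\lambda$ of the cyclic subgroups generated by primitive parabolics, so that a parabolic and its inverse are not distinguished. *)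

(* Defs.v *)
From HB Require Import structures.
From mathcomp Require Import all_boot all_order all_algebra.
From mathcomp Require Import generic_quotient complex.
From mathcomp Require Import boolp classical_sets reals.

Set Implicit Arguments.
Unset Strict Implicit.
Unset Printing Implicit Defensive.

Import GRing.Theory.
Local Open Scope ring_scope.
Local Open Scope quotient_scope.
Local Open Scope classical_set_scope.

Section SL2.
Variable F : fieldType.

Record SL2 := MkSL2 { SL2_val :> 'M[F]_2; _ : \det SL2_val == 1 }.

HB.instance Definition _ := [isSub for SL2_val].
HB.instance Definition _ := [Choice of SL2 by <:].

Implicit Types A B C : SL2.

Lemma det_SL2 A : \det A = 1.
Proof. by apply/eqP; case: A. Qed.

Lemma SL2_unit A : (A : 'M_2) \in unitmx.
Proof. by rewrite unitmxE det_SL2 unitr1. Qed.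

Fact SL2_one_subproof : \det (1%:M : 'M[F]_2) == 1.
Proof. by rewrite det1. Qed.

Fact SL2_mul_subproof A B : \det ((A : 'M_2) *m B) == 1.
Proof. by rewrite det_mulmx !det_SL2 mulr1. Qed.

Fact SL2_inv_subproof A : \det (invmx A) == 1.
Proof. by rewrite det_inv det_SL2 invr1. Qed.

Fact SL2_opp_subproof A : \det (- (A : 'M_2)) == 1.
Proof. by rewrite -scaleN1r detZ det_SL2 mulr1 sqrrN expr1n. Qed.

Definition SL2_one := MkSL2 SL2_one_subproof.
Definition SL2_mul A B := MkSL2 (SL2_mul_subproof A B).
Definition SL2_inv A := MkSL2 (SL2_inv_subproof A).
Definition SL2_opp A := MkSL2 (SL2_opp_subproof A).

Fact SL2_mulA : associative SL2_mul.
Proof. by move=> A B C; apply: val_inj; rewrite /= mulmxA. Qed.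

Fact SL2_mul1 : left_id SL2_one SL2_mul.
Proof. by move=> A; apply: val_inj; rewrite /= mul1mx. Qed.

Fact SL2_1mul : right_id SL2_one SL2_mul.
Proof. by move=> A; apply: val_inj; rewrite /= mulmx1. Qed.

Fact SL2_mulV : left_inverse SL2_one SL2_inv SL2_mul.
Proof. by move=> A; apply: val_inj; rewrite /= mulVmx ?SL2_unit. Qed.

Fact SL2_Vmul : right_inverse SL2_one SL2_inv SL2_mul.
Proof. by move=> A; apply: val_inj; rewrite /= mulmxV ?SL2_unit. Qed.

HB.instance Definition _ :=
  isGroup.Build SL2 SL2_mulA SL2_mul1 SL2_1mul SL2_mulV SL2_Vmul.

Lemma SL2_opp_mull A B : SL2_opp (A * B)%g = (SL2_opp A * B)%g.
Proof. by apply: val_inj; rewrite /= mulNmx. Qed.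

Lemma SL2_opp_mulr A B : SL2_opp (A * B)%g = (A * SL2_opp B)%g.
Proof. by apply: val_inj; rewrite /= mulmxN. Qed.

Lemma SL2_oppK : involutive SL2_opp.
Proof. by move=> A; apply: val_inj; rewrite /= opprK. Qed.

Lemma SL2_oppV A : SL2_opp A^-1%g = (SL2_opp A)^-1%g.
Proof.
apply: (mulgI (SL2_opp A)).
by rewrite mulgV -SL2_opp_mull -SL2_opp_mulr SL2_oppK mulgV.
Qed.

Definition eq_upto_sign A B := (A == B) || (A == SL2_opp B).

Fact eq_upto_sign_refl : reflexive eq_upto_sign.
Proof. by move=> A; rewrite /eq_upto_sign eqxx. Qed.

Fact eq_upto_sign_sym : symmetric eq_upto_sign.
Proof.
move=> A B; rewrite /eq_upto_sign [B == A]eq_sym; congr (_ || _).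
by apply/eqP/eqP => ->; rewrite SL2_oppK.
Qed.

Fact eq_upto_sign_trans : transitive eq_upto_sign.
Proof.
move=> B A C; rewrite /eq_upto_sign.
by move=> /orP[]/eqP-> /orP[]/eqP->; rewrite ?SL2_oppK eqxx ?orbT.
Qed.

Canonical eq_upto_sign_equiv :=
  EquivRel eq_upto_sign eq_upto_sign_refl eq_upto_sign_sym eq_upto_sign_trans.

Definition PSL2 := {eq_quot eq_upto_sign}.

HB.instance Definition _ := Choice.on PSL2.
HB.instance Definition _ := EqQuotient.on PSL2.

Definition PSL2_of A : PSL2 := \pi_PSL2 A.
Definition PSL2_repr (x : PSL2) : SL2 := repr x.

Lemma PSL2_reprK : cancel PSL2_repr PSL2_of.
Proof. exact: reprK. Qed.

Lemma eq_PSL2_of A B :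
  PSL2_of A = PSL2_of B <-> A = B \/ A = SL2_opp B.
Proof.
split; first by move/eqmodP/orP => -[]/eqP ->; [left|right].
by move=> AB; apply/eqmodP/orP; case: AB => ->; [left|right].
Qed.

Definition PSL2_one : PSL2 := PSL2_of 1%g.
Definition PSL2_mul (x y : PSL2) : PSL2 := PSL2_of (PSL2_repr x * PSL2_repr y)%g.
Definition PSL2_inv (x : PSL2) : PSL2 := PSL2_of (PSL2_repr x)^-1%g.

Lemma PSL2_of_repr A :
  PSL2_repr (PSL2_of A) = A \/ PSL2_repr (PSL2_of A) = SL2_opp A.
Proof. by apply/eq_PSL2_of; exact: PSL2_reprK. Qed.

Lemma PSL2_mulE A B :
  PSL2_mul (PSL2_of A) (PSL2_of B) = PSL2_of (A * B)%g.
Proof.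
apply/eq_PSL2_of; case: (PSL2_of_repr A) (PSL2_of_repr B) => -> [] ->.
- by left.
- by right; rewrite SL2_opp_mulr.
- by right; rewrite SL2_opp_mull.
- by left; rewrite -SL2_opp_mulr -SL2_opp_mull SL2_oppK.
Qed.

Lemma PSL2_invE A : PSL2_inv (PSL2_of A) = PSL2_of A^-1%g.
Proof.
by apply/eq_PSL2_of; rewrite SL2_oppV; case: (PSL2_of_repr A) => ->; [left|right].
Qed.

Fact PSL2_mulA : associative PSL2_mul.
Proof.
move=> x y z; rewrite -[x]PSL2_reprK -[y]PSL2_reprK -[z]PSL2_reprK.
by do 4![rewrite PSL2_mulE]; rewrite mulgA.
Qed.

Fact PSL2_mul1 : left_id PSL2_one PSL2_mul.
Proof. by move=> x; rewrite -[x]PSL2_reprK PSL2_mulE mul1g. Qed.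

Fact PSL2_1mul : right_id PSL2_one PSL2_mul.
Proof. by move=> x; rewrite -[x]PSL2_reprK PSL2_mulE mulg1. Qed.

Fact PSL2_mulV : left_inverse PSL2_one PSL2_inv PSL2_mul.
Proof. by move=> x; rewrite -[x]PSL2_reprK PSL2_invE PSL2_mulE mulVg. Qed.

Fact PSL2_Vmul : right_inverse PSL2_one PSL2_inv PSL2_mul.
Proof. by move=> x; rewrite -[x]PSL2_reprK PSL2_invE PSL2_mulE mulgV. Qed.

HB.instance Definition _ :=
  isGroup.Build PSL2 PSL2_mulA PSL2_mul1 PSL2_1mul PSL2_mulV PSL2_Vmul.

Lemma PSL2_of1 : PSL2_of 1%g = 1%g :> PSL2.
Proof. by []. Qed.

Lemma PSL2_ofM A B : PSL2_of (A * B)%g = (PSL2_of A * PSL2_of B)%g :> PSL2.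
Proof. by rewrite -PSL2_mulE. Qed.

Lemma PSL2_ofV A : PSL2_of A^-1%g = (PSL2_of A)^-1%g :> PSL2.
Proof. by rewrite -PSL2_invE. Qed.

(* The trace is only defined up to sign on PSL(2, F), but its square does not
   depend on the chosen representative: see parabolic_of. *)
Definition parabolic (h : PSL2) : Prop :=
  h <> 1%g /\ (\tr (PSL2_repr h : 'M[F]_2)) ^+ 2 = 4%:R.

Lemma parabolic_of A :
  parabolic (PSL2_of A) <-> PSL2_of A <> 1%g :> PSL2 /\ (\tr A) ^+ 2 = 4%:R.
Proof.
rewrite /parabolic.
by case: (PSL2_of_repr A) => -> //=; rewrite raddfN /= sqrrN.
Qed.

Definition mx2 (a b c d : F) : 'M[F]_2 :=
  \matrix_(i < 2, j < 2)
    if i == 0 then (if j == 0 then a else b) else (if j == 0 then c else d).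

Lemma det_mx2 a b c d : \det (mx2 a b c d) = a * d - b * c.
Proof.
rewrite (expand_det_row _ ord0) !big_ord_recl big_ord0 /cofactor.
rewrite !det_mx11 !mxE /= /bump /= !addn0 expr0 expr1 mul1r mulN1r mulrN.
by rewrite addr0.
Qed.

Fact S_subproof : \det (mx2 1 0 1 1) == 1.
Proof. by rewrite det_mx2 mul0r subr0 mulr1. Qed.

Fact T_subproof l : \det (mx2 1 (2%:R * l) 0 1) == 1.
Proof. by rewrite det_mx2 mulr0 subr0 mulr1. Qed.

Definition S_mx : SL2 := MkSL2 S_subproof.
Definition T_mx (l : F) : SL2 := MkSL2 (T_subproof l).

End SL2.

Section Subgroups.
Variable gT : groupType.
Implicit Types (g h x : gT) (G X : set gT).
Local Open Scope group_scope.

Definition generated X : set gT :=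
  smallest (fun H : set gT => group_closed [in H]) X.

Definition expgz g (m : int) : gT :=
  match m with Posz n => g ^+ n | Negz n => g ^- n.+1 end.

Definition cyclic_gen g : set gT := range (expgz g).

(* A word is a sequence of letters, where (x, false) stands for x and (x, true) for x^-1. *)
Definition letter : Type := (gT * bool)%type.
Definition letter_val (l : letter) : gT := if l.2 then l.1^-1 else l.1.
Definition word_val (w : seq letter) : gT := \prod_(l <- w) letter_val l.

Definition reduced (w : seq letter) : bool :=
  sorted (fun l l' : letter => ~~ ((l.1 == l'.1) && (l.2 != l'.2))) w.

Definition free_basis G X : Prop :=
  X `<=` G /\
  forall g, G g ->
    exists! w : seq letter,
      [/\ forall l, l \in w -> X l.1, reduced w & word_val w = g].

(* The basis may be empty or infinite. *)
Definition free_group G : Prop := exists X, free_basis G X.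

Definition conj_cyclic G h1 h2 : Prop :=
  exists2 g, G g & [set x ^ g | x in cyclic_gen h1] = cyclic_gen h2.

End Subgroups.

Definition primitive_parabolic (F : fieldType) (G : set (PSL2 F)) (h : PSL2 F)
    : Prop :=
  [/\ G h, parabolic h &
      forall (g : PSL2 F) (m : int), G g -> h = expgz g m -> m = 1 \/ m = -1].

(* Classes of cyclic subgroups are counted, so h and h^-1 count only once. *)
Definition parabolic_dust (F : fieldType) (G : set (PSL2 F)) : Prop :=
  exists h1 h2 h3 : PSL2 F,
    [/\ primitive_parabolic G h1, primitive_parabolic G h2
      & primitive_parabolic G h3] /\
    [/\ ~ conj_cyclic G h1 h2, ~ conj_cyclic G h1 h3 & ~ conj_cyclic G h2 h3].

Definition G_ (F : fieldType) (l : F) : set (PSL2 F) :=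
  generated [set PSL2_of (S_mx F); PSL2_of (T_mx l)].

Definition f_quad (F : fieldType) (z : F) : F := - 2%:R * z ^+ 2.

(* Main.v *)
Require Import Defs.
From mathcomp Require Import all_boot all_order all_algebra complex reals.
From mathcomp Require Import perm boolp classical_sets zify ring.

Set Implicit Arguments.
Unset Strict Implicit.
Unset Printing Implicit Defensive.

Import Order.TTheory GRing.Theory Num.Theory.

(** Write [s] and [t] for the classes of [S] and [T_l], [G = <s, t>] for the
group of parameter [l], and [s' = t s t^-1].  Conjugation by a lower unipotent
matrix sending the fixed point [2 l] of [s'] to infinity fixes [s] and carries
[s'] to the class of [T_(-2 l^2)].  So the group of parameter [-2 l^2] is a
conjugate of the subgroup [H = <s, s'>] of [G] ([S_conj_N], [T_conj_N]), and it
is enough to compare [G] with [H] and to iterate.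

Suppose that [G] is free.  As [s] and [t] do not commute, they form a basis of
[G] ([free_pair]): this is the Hopf property in rank two, obtained by counting
the actions of [G] on the finite sets [(Z/m)^2] and by a ping-pong argument for
shears of [Z^2].

The tool used throughout is that a free group acts on any set by prescribing
bijections for its basis elements ([free_basis_action]).  Here the sets are of
the form [Z * E]: the generator [t] shifts the level in [Z], and [s] acts on [E]
by a bijection that depends on the level ([level_action]).  This induced action
sees the conjugates [t^j s t^-j] separately.
 - Letting [s] act by two ping-pong shears at the levels [0] and [-1] shows that
   [s], [s'] is a basis of [H], which is the second claim ([free_conj_pair]).
 - Letting [s] act on [E = G] by multiplication by [s] and [s'] at these levels,
   and trivially at the others, plays the role of the retraction onto [H] of the
   kernel of the [t]-exponent.  Consequently, if a conjugate in [G] of a power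
   of [s] lies in [H], then it is conjugate in [H] to a power of [s] or of [s']
   ([conj_s_retract]), while nontrivial powers of [t] have no conjugate in [H]
   ([conj_t_notin]).

For the first claim, [s] and [t] are primitive parabolics of [G] in different
classes.  Among three classes of [H], one is given by some [h] that is conjugate
in [H] neither to [s] nor to [s'].  In the free group [G] this [h] is a power of
a primitive element [g] ([free_root]), and [g] is parabolic because its power is
([parabolic_root]).  If [g] were conjugate to a power of [t] or [s], then so
would [h]; the former contradicts [h <> 1], and the latter makes [h], which is
primitive in [H], conjugate in [H] to [s] or [s'], contrary to its choice. *)

(** * Subgroups, integer powers and classes of cyclic subgroups *)

Section Subgroup.
Variable gT : groupType.
Implicit Types (g h x y : gT) (G H X : set gT).
Local Open Scope group_scope.
Local Open Scope classical_set_scope.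

Definition subgroup G : Prop :=
  [/\ G 1, forall x y, G x -> G y -> G (x * y) & forall x, G x -> G x^-1].

Lemma subgroup_closed G : group_closed [in G] <-> subgroup G.
Proof.
split=> [clG|[G1 GM GV]].
  have GV := group_closedV clG; have GM := group_closedM clG.
  split; first by have [+ _] := clG; rewrite inE.
    by move=> x y Gx Gy; have := GM x y; rewrite !inE; exact.
  by move=> x Gx; have := GV x; rewrite !inE; exact.
split; first by rewrite inE.
by move=> x y; rewrite !inE => Gx Gy; apply: GM => //; exact: GV.
Qed.

Lemma generated_subgroup X : subgroup (generated X).
Proof.
split=> [H [/subgroup_closed[H1 _ _] _] //|x y Xx Xy|x Xx] H HX;
  have [/subgroup_closed[_ HM HV] _] := HX.
  by apply: HM; [exact: Xx | exact: Xy].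
by apply: HV; exact: Xx.
Qed.

Lemma sub_generated X : X `<=` generated X.
Proof. by move=> x Xx H [_]; exact. Qed.

Lemma generated_min X H : subgroup H -> X `<=` H -> generated X `<=` H.
Proof. by move=> /subgroup_closed sH XH x; exact. Qed.

Lemma subgroupX G x n : subgroup G -> G x -> G (x ^+ n).
Proof.
move=> [G1 GM _] Gx; elim: n => [|n IH]; first by rewrite expg0.
by rewrite expgS; exact: GM.
Qed.

Lemma subgroupJ G x y : subgroup G -> G x -> G y -> G (x ^ y).
Proof. by move=> [_ GM GV] Gx Gy; apply: (GM); [apply: GV | apply: GM]. Qed.

Lemma subgroup_expgz G x k : subgroup G -> G x -> G (expgz x k).
Proof.
move=> sG Gx; have [_ _ GV] := sG.
by case: k => n /=; [|apply: GV]; exact: subgroupX.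
Qed.

Lemma expgzN x k : expgz x (- k)%R = (expgz x k)^-1.
Proof. by case: k => [[|n]|n] /=; rewrite ?expg0 ?invg1 ?invgK. Qed.

Lemma expgzJ x y k : expgz (x ^ y) k = expgz x k ^ y.
Proof. by case: k => n; rewrite /= -conjXg ?conjVg. Qed.

Lemma expgzM x a b : expgz (expgz x a) b = expgz x (a * b)%R.
Proof.
have posE m n : expgz (expgz x m%:Z) n%:Z = expgz x (m%:Z * n%:Z)%R.
  by rewrite -PoszM /= expgnA.
have negE m n : expgz (expgz x (- m%:Z)%R) n%:Z = expgz x (- m%:Z * n%:Z)%R.
  by rewrite mulNr !expgzN -posE /= expVgn.
case: (intP a) (intP b) => [|m|m] [|n|n]; rewrite ?mulr0 ?mul0r //;
  rewrite ?mulrN ?mulNr ?expgzN ?invgK -?PoszM //=.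
all: rewrite ?expg1n ?expg0 ?invg1 ?expVgn ?invgK ?expgnA //.
Qed.

Lemma expg1z k : expgz (1 : gT) k = 1.
Proof. by case: k => n /=; rewrite expg1n ?invg1. Qed.

Lemma conj_cyclicP G h1 h2 :
  conj_cyclic G h1 h2 ->
  exists g a b, [/\ G g, h1 ^ g = expgz h2 a & h2 = expgz h1 b ^ g].
Proof.
case=> g Gg E.
have : cyclic_gen h2 (h1 ^ g) by rewrite -E; exists h1 => //; exists 1%R.
have : [set x ^ g | x in cyclic_gen h1] h2 by rewrite E; exists 1%R.
by move=> [_ [b _ <-] Eb] [a _ Ea]; exists g, a, b.
Qed.

Lemma conj_cyclic_sym G h1 h2 : subgroup G ->
  conj_cyclic G h1 h2 -> conj_cyclic G h2 h1.
Proof.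
move=> [_ _ GV] [g Gg E]; exists g^-1; first exact: GV.
apply/seteqP; split=> y.
  by case=> x; rewrite -E => -[z Cz <-] <-; rewrite conjgK.
by move=> Cy; exists (y ^ g); [rewrite -E; exists y | rewrite conjgK].
Qed.

Lemma conj_cyclic_trans G h1 h2 h3 : subgroup G ->
  conj_cyclic G h1 h2 -> conj_cyclic G h2 h3 -> conj_cyclic G h1 h3.
Proof.
move=> [_ GM _] [g Gg E] [k Gk E']; exists (g * k); first exact: GM.
rewrite -E' -E; apply/seteqP; split=> y.
  by case=> x Cx <-; exists (x ^ g); [exists x | rewrite conjgM].
by case=> _ [x Cx <-] <-; exists x => //; rewrite conjgM.
Qed.

Lemma conj_cyclic_expgz G h s c k : G c -> (k = 1 \/ k = -1)%R ->
  h ^ c = expgz s k -> conj_cyclic G h s.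
Proof.
move=> Gc k1 E; exists c => //; apply/seteqP; split=> y.
  by case=> _ [a _ <-] <-; rewrite -expgzJ E expgzM; eexists.
case=> a _ <-; exists (expgz h (k * a)%R); first by eexists.
by rewrite -expgzJ E expgzM mulrA; case: k1 => ->; rewrite ?mulrNN !mul1r.
Qed.

End Subgroup.

(** * Words and actions of free groups *)

Section Words.
Variable gT : groupType.
Implicit Types (g h x y : gT) (G H X : set gT) (l : letter gT)
  (w : seq (letter gT)).
Local Open Scope group_scope.
Local Open Scope classical_set_scope.

Definition letters_in X w : Prop := forall l, l \in w -> X l.1.

Lemma letters_in_cons X l w :
  letters_in X (l :: w) <-> X l.1 /\ letters_in X w.
Proof.
split=> [Xw|[Xl Xw] k]; last by rewrite inE => /orP[/eqP->|/Xw].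
by split=> [|k kw]; apply: Xw; rewrite inE ?eqxx ?kw ?orbT.
Qed.

Lemma letters_in_cat X w1 w2 :
  letters_in X w1 -> letters_in X w2 -> letters_in X (w1 ++ w2).
Proof. by move=> X1 X2 l; rewrite mem_cat => /orP[/X1|/X2]. Qed.

Lemma word_val_nil : word_val [::] = 1 :> gT.
Proof. exact: big_nil. Qed.

Lemma word_val_cons l w : word_val (l :: w) = letter_val l * word_val w.
Proof. exact: big_cons. Qed.

Lemma word_val_cat w1 w2 : word_val (w1 ++ w2) = word_val w1 * word_val w2.
Proof. exact: big_cat. Qed.

Lemma subgroup_word_val G X w : subgroup G -> X `<=` G -> letters_in X w ->
  G (word_val w).
Proof.
move=> [G1 GM GV] XG; elim: w => [|l w IH]; first by rewrite word_val_nil.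
move=> /letters_in_cons[Xl /IH Gw]; rewrite word_val_cons; apply: (GM) => //.
by rewrite /letter_val; case: l.2; [apply: GV|]; exact: XG.
Qed.

Lemma generated_word X g : generated X g ->
  exists2 w, letters_in X w & word_val w = g.
Proof.
move: g; apply: generated_min => [|x Xx]; last first.
  exists [:: (x, false)]; first by move=> l; rewrite inE => /eqP->.
  by rewrite word_val_cons word_val_nil mulg1.
split; first by exists [::]; rewrite ?word_val_nil.
  move=> _ _ [w1 X1 <-] [w2 X2 <-]; exists (w1 ++ w2).
    exact: letters_in_cat.
  exact: word_val_cat.
move=> _ [w Xw <-]; elim: w Xw => [|l w IH].
  by exists [::]; rewrite ?word_val_nil ?invg1.
move=> /letters_in_cons[Xl /IH[w' X' E']].
exists (w' ++ [:: (l.1, ~~ l.2)]).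
  by apply: letters_in_cat => // k; rewrite inE => /eqP->.
rewrite word_val_cat (word_val_cons _ [::]) word_val_nil mulg1 E'.
rewrite word_val_cons invgM.
by congr (_ * _); rewrite /letter_val /=; case: l.2; rewrite ?invgK.
Qed.

Lemma reduced_cons l w : reduced (l :: w) -> reduced w.
Proof. exact: path_sorted. Qed.

Lemma centralizer_subgroup g : subgroup [set h | commute g h].
Proof.
split=> /= [|x y gx gy|x gx]; first exact: commute1.
  exact: commuteM.
exact: commuteV.
Qed.

Lemma generated_commute X : (forall x y, X x -> X y -> commute x y) ->
  forall g h, generated X g -> generated X h -> commute g h.
Proof.
move=> Xc g h Xg Xh; apply: (generated_min (centralizer_subgroup g)) Xh => x Xx.
apply/commute_sym; apply: (generated_min (centralizer_subgroup x)) Xg => y Xy.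
exact: Xc.
Qed.

Section Action.
Variables (E : Type) (a b : gT -> E -> E).

Definition act_letter l : E -> E := if l.2 then b l.1 else a l.1.
Definition act_word w e := foldr act_letter e w.

Lemma act_word_cat w1 w2 e :
  act_word (w1 ++ w2) e = act_word w1 (act_word w2 e).
Proof. exact: foldr_cat. Qed.

Hypotheses (aK : forall x, cancel (a x) (b x))
  (bK : forall x, cancel (b x) (a x)).

Lemma act_letterK x c e : act_letter (x, c) (act_letter (x, ~~ c) e) = e.
Proof. by rewrite /act_letter; case: c => /=; rewrite ?aK ?bK. Qed.

(** Free reduction changes neither the value of a word nor its action, since it
only deletes adjacent letters that are inverse to each other. *)
Lemma reduce_word X w : letters_in X w ->
  exists w', [/\ letters_in X w', reduced w', word_val w' = word_val w
               & act_word w' =1 act_word w].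
Proof.
elim: w => [_|[x c] w IH /letters_in_cons[/= Xx /IH[w' [Xw' rw' vw' aw']]]].
  by exists [::]; split.
case: w' => [|[y d] w'] in Xw' rw' vw' aw' *.
  exists [:: (x, c)]; split=> // [| |e].
  - by move=> l; rewrite inE => /eqP->.
  - by rewrite !word_val_cons vw'.
  - by rewrite /= -aw'.
have [/andP[/eqP xy cd]|xy] := boolP ((x == y) && (c != d)).
  exists w'; move/letters_in_cons: Xw' => [_ Xw']; split=> // [| |e].
  - exact: reduced_cons rw'.
  - rewrite word_val_cons -vw' word_val_cons mulgA -xy /letter_val /=.
    by move: cd; case: (c); case: (d) => // _; rewrite ?mulgV ?mulVg mul1g.
  - rewrite /= -aw' /= -xy; have -> : d = ~~ c by case: (c) (d) cd => [] [].
    by rewrite act_letterK.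
exists [:: (x, c), (y, d) & w']; split=> [| | |e].
- by apply/letters_in_cons.
- by move: rw'; rewrite /reduced /= => ->; rewrite xy.
- by rewrite !(word_val_cons (x, c)) vw'.
- by rewrite -[RHS]/(act_letter (x, c) (act_word w e)) -aw'.
Qed.

Lemma free_act_word G X w1 w2 : subgroup G -> free_basis G X ->
  letters_in X w1 -> letters_in X w2 -> word_val w1 = word_val w2 ->
  act_word w1 =1 act_word w2.
Proof.
move=> sG [XG fG] X1 X2 E12.
have [u1 [Xu1 ru1 vu1 au1]] := reduce_word X1.
have [u2 [Xu2 ru2 vu2 au2]] := reduce_word X2.
have [w [_ wuniq]] := fG _ (subgroup_word_val sG XG X1).
have wu1 : w = u1 by apply: wuniq.
have wu2 : w = u2 by apply: wuniq; split=> //; rewrite vu2.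
by move=> e; rewrite -au1 -au2 -wu1 wu2.
Qed.

End Action.

Definition action_on G E (phi : gT -> E -> E) : Prop :=
  (forall e, phi 1 e = e) /\
  (forall g h, G g -> G h -> forall e, phi (g * h) e = phi g (phi h e)).

(** The universal property of a free basis, with groups of bijections as
targets. *)
Lemma free_basis_action G X E (a b : gT -> E -> E) :
  subgroup G -> free_basis G X ->
  (forall x, cancel (a x) (b x)) -> (forall x, cancel (b x) (a x)) ->
  exists2 phi, action_on G phi & forall x, X x -> phi x =1 a x.
Proof.
move=> sG fG aK bK; have [XG wG] := fG.
have act_word_eq := free_act_word aK bK sG fG.
have /choice[w Pw] g : exists w, G g -> letters_in X w /\ word_val w = g.
  have [Gg|nGg] := pselect (G g); last by exists [::].
  by have [w [[Xw _ vw] _]] := wG _ Gg; exists w.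
have [G1 GM _] := sG.
exists (fun g => act_word a b (w g)).
  split=> [e|g h Gg Gh e].
    have [X1 v1] := Pw _ G1; rewrite (act_word_eq _ [::] X1) // v1.
    by rewrite word_val_nil.
  have [Xg vg] := Pw _ Gg; have [Xh vh] := Pw _ Gh.
  have [Xgh vgh] := Pw _ (GM _ _ Gg Gh).
  rewrite -act_word_cat; apply: act_word_eq => //; first exact: letters_in_cat.
  by rewrite word_val_cat vg vh.
move=> x Xx e; have [Xw vw] := Pw _ (XG _ Xx).
rewrite (act_word_eq _ [:: (x, false)] Xw) //.
  by move=> l; rewrite inE => /eqP->.
by rewrite vw word_val_cons word_val_nil mulg1.
Qed.

Section ActionTheory.
Variables (G : set gT) (E : Type) (phi : gT -> E -> E).
Hypotheses (sG : subgroup G) (aG : action_on G phi).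

Lemma action1 e : phi 1 e = e. Proof. exact: aG.1. Qed.

Lemma actionM g h e : G g -> G h -> phi (g * h) e = phi g (phi h e).
Proof. by move=> Gg Gh; exact: aG.2. Qed.

Lemma actionK g : G g -> cancel (phi g) (phi g^-1).
Proof.
move=> Gg e; have [_ _ GV] := sG; rewrite -actionM ?mulVg ?action1 //.
exact: GV.
Qed.

Lemma actionVK g : G g -> cancel (phi g^-1) (phi g).
Proof.
move=> Gg e; have [_ _ GV] := sG; rewrite -actionM ?mulgV ?action1 //.
exact: GV.
Qed.

Lemma action_word X (a b : gT -> E -> E) w e : X `<=` G ->
  (forall x, X x -> phi x =1 a x) ->
  (forall x, X x -> cancel (b x) (a x)) -> letters_in X w ->
  phi (word_val w) e = act_word a b w e.
Proof.
move=> XG pa bK; elim: w => [_|l w IH /letters_in_cons[Xl Xw]].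
  by rewrite word_val_nil action1.
have Gl := XG _ Xl; have [_ _ GV] := sG.
rewrite word_val_cons actionM ?IH //=; first last.
- exact: subgroup_word_val Xw.
- by rewrite /letter_val; case: l.2 => //; exact: GV.
rewrite /letter_val /act_letter; case: l.2; last exact: pa.
by apply: (can_inj (actionK Gl)); rewrite actionVK // pa // bK.
Qed.

End ActionTheory.

Lemma action_ext X E (phi psi : gT -> E -> E) :
  action_on (generated X) phi -> action_on (generated X) psi ->
  (forall x, X x -> phi x =1 psi x) ->
  forall g, generated X g -> phi g =1 psi g.
Proof.
move=> aphi apsi Xe g /generated_word[w Xw <-] e.
have sG := generated_subgroup X; have XG := @sub_generated gT X.
have bK x : X x -> cancel (phi x^-1) (phi x).
  by move=> /XG; exact: actionVK.
transitivity (act_word phi (fun x => phi x^-1) w e).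
  by apply: (action_word sG aphi _ XG _ bK Xw).
by symmetry; apply: (action_word sG apsi _ XG _ bK Xw) => x Xx y; rewrite Xe.
Qed.

End Words.

(** * Ping-pong for two shears of the plane *)

Section PingPong.
Variable gT : groupType.
Implicit Types (g h x y s t : gT) (G H X : set gT) (l : letter gT)
  (w : seq (letter gT)).
Local Open Scope group_scope.
Local Open Scope classical_set_scope.

Lemma free_basisI X :
  (forall w1 w2, letters_in X w1 -> letters_in X w2 -> reduced w1 ->
     reduced w2 -> word_val w1 = word_val w2 -> w1 = w2) ->
  free_basis (generated X) X.
Proof.
move=> inj; split=> [|g /generated_word[w Xw <-]]; first exact: sub_generated.
pose id2 := fun (_ : gT) (u : unit) => u.
have idK x : cancel (id2 x) (id2 x) by [].
have [u [Xu ru vu _]] := reduce_word idK idK Xw.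
by exists u; split=> // u' [Xu' ru' vu']; apply: inj; rewrite ?vu.
Qed.

Section Shears.
Variable Q : comNzRingType.
Local Open Scope ring_scope.

(** The letter [s] shears along the first axis, every other letter along the
second one: on words in [s] and [t] these are the two elementary matrices with
off-diagonal entry [k]. *)
Definition shear s (k : Q) (x : gT) (p : Q * Q) : Q * Q :=
  if x == s then (p.1 + k * p.2, p.2) else (p.1, p.2 + k * p.1).

Lemma shearK s k x : cancel (shear s k x) (shear s (- k) x).
Proof.
by move=> [p1 p2]; rewrite /shear; case: (x == s) => /=; congr (_, _); ring.
Qed.

Lemma shearNK s k x : cancel (shear s (- k) x) (shear s k x).
Proof. by have := shearK s (- k) x; rewrite opprK. Qed.

End Shears.

(** With the coefficient [2], an inverse shear would move the base point [(1, 1)] to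
[(-1, 1)] or [(1, -1)], on the boundary of the cones below; [3] avoids this. *)
Definition shear_word (Q : comNzRingType) s w : Q * Q :=
  act_word (shear s 3%:R) (shear s (- 3%:R)%R) w (1%R, 1%R).

Lemma shear_word_int (Q : comNzRingType) s w :
  shear_word Q s w =
  let p := shear_word int s w in (p.1%:~R%R, p.2%:~R%R).
Proof.
rewrite /shear_word; elim: w => [//|[x c] w IH] /=; rewrite IH /=.
move: (act_word _ _ _ _) => [p1 p2]; rewrite /act_letter /shear /=.
by case: c; case: (x == s) => /=; congr (_, _); rewrite intrD intrM ?intrN.
Qed.

(** With slope [z = x / y], the letters [s], [s^-1], [t], [t^-1] map [(1, 1)] and
all the cones but that of the inverse letter into [z > 1], [z < -1],
[0 < z < 1], [-1 < z < 0] respectively. *)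
Definition cone (c d : bool) (p : int * int) : Prop :=
  let: (x, y) := p in
  match c, d with
  | true, false => (0 < y /\ y < x)%R \/ (x < y /\ y < 0)%R
  | true, true => (0 < y /\ y < - x)%R \/ (- x < y /\ y < 0)%R
  | false, false => (0 < x /\ x < y)%R \/ (y < x /\ x < 0)%R
  | false, true => (0 < x /\ x < - y)%R \/ (- y < x /\ x < 0)%R
  end.

Lemma cone_inj b c b' c' p : cone b c p -> cone b' c' p -> b = b' /\ c = c'.
Proof.
case: p => p1 p2; case: b; case: c; case: b'; case: c' => //= C1 C2.
all: try (exfalso; lia).
Qed.

Lemma shear_cone s t l w : letters_in [set s; t] (l :: w) -> reduced (l :: w) ->
  cone (l.1 == s) l.2 (shear_word int s (l :: w)).
Proof.
rewrite /shear_word; elim: w l => [|k w IH] [x d].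
  move=> _ _; rewrite /= /act_letter /shear.
  by case: d; case: (x == s) => /=; lia.
move=> /letters_in_cons[/= xst Xw] rw.
have [kst _] := iffLR (letters_in_cons _ _ _) Xw.
have [+ rkw] := andP rw; have {IH} := IH k Xw rkw.
case: k kst {Xw rw rkw} => y c /= yst.
move=> + xy; move: xy; have -> : (x == y) = ((x == s) == (y == s)).
  by case: xst => ->; case: yst => ->; rewrite ?eqxx ?[t == s]eq_sym //;
    case: (s == t).
rewrite -/(act_word _ _ w (1%R, 1%R)); move: (act_letter _ _ _ _) => [p1 p2].
rewrite /act_letter /shear.
by case: d; case: c; case: (x == s); case: (y == s) => //= _; lia.
Qed.

(** The cone that contains the image of [(1, 1)] reveals the first letter of a
reduced word; the word is then recovered letter by letter. *)
Lemma shear_word_inj s t w1 w2 :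
  letters_in [set s; t] w1 -> letters_in [set s; t] w2 ->
  reduced w1 -> reduced w2 ->
  shear_word int s w1 = shear_word int s w2 -> w1 = w2.
Proof.
have base c d : ~ cone c d (shear_word int s [::]).
  by rewrite /shear_word; case: c; case: d => /=; lia.
elim: w1 w2 => [|l1 w1 IH] [|l2 w2] // X1 X2 r1 r2.
- by move=> E; have := shear_cone X2 r2; rewrite -E => /base.
- by move=> E; have := shear_cone X1 r1; rewrite E => /base.
move=> E; have := shear_cone X1 r1.
have := shear_cone X2 r2; rewrite -E => C2 C1.
have {C1 C2} l12 : l1 = l2.
  case: l1 l2 X1 X2 {r1 r2 E} C1 C2 => x c [y d].
  move=> /letters_in_cons[/= xst _] /letters_in_cons[/= yst _].
  move=> C1 C2; have [xy cd] := cone_inj C1 C2.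
  rewrite cd; congr (_, _); case: xst xy => ->; case: yst => -> //.
    by rewrite eqxx; case: eqP.
  by rewrite eqxx; case: eqP.
rewrite l12 in E *; congr (_ :: _); apply: IH; last 1 first.
- move: E; rewrite /shear_word /= /act_letter; case: l2.2 => /=.
    by move/(can_inj (@shearNK _ _ _ _)).
  by move/(can_inj (@shearK _ _ _ _)).
- by move/letters_in_cons: X1 => [].
- by move/letters_in_cons: X2 => [].
- exact: reduced_cons r1.
- exact: reduced_cons r2.
Qed.

Lemma intr_Zp_inj (m : nat) (a b : int) : (`|a - b| < m.+2)%N ->
  a%:~R%R = b%:~R%R :> 'Z_m.+2 -> a = b.
Proof.
move=> lt_m /eqP; rewrite -subr_eq0 -intrB => /eqP E.
have E' : (`|a - b|%N)%:R%R = 0%R :> 'Z_m.+2.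
  by move: E; case: (intP (a - b)%R) => [|n|n] //;
    rewrite ?absz0 // intrN => /eqP; rewrite oppr_eq0 abszN => /eqP.
move/(congr1 val): E'; rewrite Zp_nat /= modn_small //.
by move=> /eqP; rewrite absz_eq0 subr_eq0 => /eqP.
Qed.

End PingPong.

(** * Two generators of a free group *)

Section TwoGen.
Variable gT : groupType.
Implicit Types (g h x y s t : gT) (G H X : set gT) (l : letter gT)
  (w : seq (letter gT)).
Local Open Scope group_scope.
Local Open Scope classical_set_scope.

Lemma free_basis_sub_generated G X : free_basis G X -> G `<=` generated X.
Proof.
move=> [_ fG] g /fG[w [[Xw _ <-] _]].
by apply: subgroup_word_val (@sub_generated _ X) Xw; exact: generated_subgroup.
Qed.

Lemma free_basis_two G X s t : free_basis G X -> G s -> G t -> s * t <> t * s ->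
  exists x y, [/\ X x, X y & x <> y].
Proof.
move=> fG /(free_basis_sub_generated fG) Xs /(free_basis_sub_generated fG) Xt.
move=> st_nc; apply: contrapT => nX; apply: st_nc.
apply: generated_commute Xs Xt => x y Xx Xy.
have -> : y = x; last exact: commute_refl.
by apply: contrapT => yx; apply: nX; exists y, x.
Qed.

(** Two distinct elements [x], [y] of a basis can be mapped to any pair of
permutations of [E], and the resulting action is determined by the images of
the generators [s] and [t].  This gives an injection of a finite set of pairs of
permutations into itself; being onto, it realizes every pair at [s] and [t]. *)
Lemma free_realizes_perms X s t (E : finType) (p q : {perm E}) :
  free_basis (generated [set s; t]) X -> s * t <> t * s ->
  exists2 phi, action_on (generated [set s; t]) phi
    & phi s =1 p /\ phi t =1 q.
Proof.
set G := generated _ => fG st_nc; have sG : subgroup G := generated_subgroup _.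
have Gs : G s by apply: sub_generated; left.
have Gt : G t by apply: sub_generated; right.
have [x [y [Xx Xy xy]]] := free_basis_two fG Gs Gt st_nc.
pose a (pq : {perm E} * {perm E}) z : {perm E} :=
  if z == x then pq.1 else if z == y then pq.2 else perm_one E.
have /choice[phi phiP] (pq : {perm E} * {perm E}) :
    exists phi, action_on G phi /\ phi x =1 pq.1 /\ phi y =1 pq.2.
  have [phi aphi phiX] := free_basis_action (a := fun z e => a pq z e)
    (b := fun z e => (a pq z)^-1%g e) sG fG
    (fun z => permK _) (fun z => permKV _).
  exists phi; split=> //; split=> e; rewrite phiX // /a ?eqxx //.
  by case: eqP => // /esym.
have inj z pq : G z -> injective (phi pq z).
  by move=> Gz; apply: can_inj (actionK sG (phiP pq).1 Gz).
pose Phi pq := (perm (inj s pq Gs), perm (inj t pq Gt)).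
have Phi_inj : injective Phi.
  move=> pq pq' /= [/permP Es /permP Et].
  have agree z : [set s; t] z -> phi pq z =1 phi pq' z.
    by case=> -> e; [have := Es e | have := Et e]; rewrite !permE.
  have ext := action_ext (phiP pq).1 (phiP pq').1 agree.
  have [[_ [px py]] [_ [px' py']]] := (phiP pq, phiP pq').
  have [XG _] := fG.
  rewrite [pq]surjective_pairing [pq']surjective_pairing.
  by congr (_, _); apply/permP => e;
    [rewrite -px -px' | rewrite -py -py']; apply: ext; exact: XG.
have [Psi _ PhiK] := injF_bij Phi_inj.
have [/permP Es /permP Et] := PhiK (p, q); exists (phi (Psi (p, q))).
  exact: (phiP _).1.
by split=> e; [have := Es e | have := Et e]; rewrite permE.
Qed.

(** The group acts on [(Z/m)^2] with [s] and [t] acting as the reductions of the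
two shears, so words of equal value move [(1, 1)] to points of [Z^2] that are
congruent modulo [m]; for [m] larger than their distance the points agree, and
ping-pong applies. *)
Theorem free_pair s t : free_group (generated [set s; t]) ->
  s * t <> t * s -> free_basis (generated [set s; t]) [set s; t].
Proof.
move=> [X fX] st_nc; apply: free_basisI => w1 w2 X1 X2 r1 r2 E12.
apply: (shear_word_inj X1 X2 r1 r2).
set p1 := shear_word _ _ w1; set p2 := shear_word _ _ w2.
pose m := (`|p1.1 - p2.1| + `|p1.2 - p2.2|)%N.
pose E := ('Z_m.+2 * 'Z_m.+2)%type.
pose shp x : {perm E} :=
  perm (can_inj (@shearK gT 'Z_m.+2 s 3%:R%R x)).
have [phi aphi [phis phit]] := free_realizes_perms (shp s) (shp t) fX st_nc.
have phiE w : letters_in [set s; t] w ->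
    phi (word_val w) (1, 1)%R = shear_word 'Z_m.+2 s w.
  move=> Xw; apply: (action_word (generated_subgroup _) aphi _ _ _ _ Xw).
  - exact: sub_generated.
  - by move=> x [] -> e; rewrite ?phis ?phit permE.
  - by move=> x _; exact: shearNK.
have := phiE _ X1; rewrite E12 phiE // !(shear_word_int 'Z_m.+2) => -[E1 E2].
rewrite [p1]surjective_pairing [p2]surjective_pairing.
congr (_, _); apply: (@intr_Zp_inj m) => //.
all: by rewrite /m; lia.
Qed.

End TwoGen.

(** * The subgroup generated by s and its conjugate under t *)

Section FreePair.
Variables (gT : groupType) (s t : gT).
Implicit Types (g h x y : gT) (w : seq (letter gT)).
Local Open Scope group_scope.
Local Open Scope classical_set_scope.

Local Notation G := (generated [set s; t]).
Hypotheses (freeG : free_basis G [set s; t]) (st_nc : s * t <> t * s).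

Let sG : subgroup G := generated_subgroup _.
Let Gs : G s. Proof. by apply: sub_generated; left. Qed.
Let Gt : G t. Proof. by apply: sub_generated; right. Qed.

Lemma free_pair_neq : (t == s) = false.
Proof. by apply/eqP => ts; apply: st_nc; rewrite ts. Qed.

(** The exponent sum in [s] is the translation length of the action on [Z] for
which [s] adds [1] and [t] adds [0]. *)
Lemma exponent_sum : exists eps : gT -> int,
  [/\ forall g h, G g -> G h -> eps (g * h) = (eps g + eps h)%R,
      eps s = 1%R & eps t = 0%R].
Proof.
pose d x : int := if x == s then 1%R else 0%R.
have [phi aphi phiX] := free_basis_action (a := fun x (z : int) => (z + d x)%R)
  (b := fun x z => (z - d x)%R) sG freeG (fun x => addrK _) (fun x => subrK _).
have transl g : G g -> forall z, phi g z = (z + phi g 0)%R.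
  move=> /generated_word[w Xw <-].
  have E z : phi (word_val w) z =
      (z + \sum_(l <- w) if l.2 then - d l.1 else d l.1)%R.
    rewrite (action_word sG aphi _ (@sub_generated _ _) phiX
      (fun x _ => subrK _) Xw).
    elim: w {Xw} => [|l w IH]; first by rewrite big_nil addr0.
    rewrite big_cons /= IH /act_letter.
    by case: l.2; rewrite -addrA [X in (z + X)%R]addrC.
  by move=> z; rewrite !E add0r.
exists (phi ^~ 0%R); split=> [g h Gg Gh||].
- by rewrite (actionM aphi) // transl // addrC.
- by rewrite phiX; [rewrite /d eqxx add0r | left].
- by rewrite phiX; [rewrite /d free_pair_neq addr0 | right].
Qed.

Lemma exponent_expgz (eps : gT -> int) g k :
  (forall g h, G g -> G h -> eps (g * h) = (eps g + eps h)%R) -> G g ->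
  eps (expgz g k) = (k * eps g)%R.
Proof.
move=> epsM Gg; have [G1 _ GV] := sG.
have eps1 : eps 1 = 0%R.
  by apply: (addrI (eps 1)); rewrite -epsM // mulg1 addr0.
have epsX n : eps (g ^+ n) = (n%:Z * eps g)%R.
  elim: n => [|n IH]; first by rewrite expg0 eps1 mul0r.
  by rewrite expgS epsM ?IH //; [rewrite intS mulrDl mul1r | exact: (subgroupX _ sG)].
case: k => n; rewrite /= ?epsX //.
apply: (addrI (eps (g ^+ n.+1))); rewrite -epsM.
- by rewrite mulgV eps1 epsX NegzE mulNr addrN.
- exact: (subgroupX _ sG).
- by apply: GV; exact: (subgroupX _ sG).
Qed.

(** This is the action of the group induced from the kernel of the [t]-exponent,
which is free on the conjugates [t^j s t^-j]: the bijection [a j] is the action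
of [s] at level [j], hence that of [t^(-j) s t^j] at level [0]. *)
Lemma level_action (E : Type) (a b : int -> E -> E) :
  (forall j, cancel (a j) (b j)) -> (forall j, cancel (b j) (a j)) ->
  exists phi, [/\ action_on G phi,
    forall j e, phi s (j, e) = (j, a j e) &
    forall j e, phi t (j, e) = ((j + 1)%R, e)].
Proof.
move=> aK bK.
pose u x (p : int * E) :=
  if x == s then (p.1, a p.1 p.2) else ((p.1 + 1)%R, p.2).
pose v x (p : int * E) :=
  if x == s then (p.1, b p.1 p.2) else ((p.1 - 1)%R, p.2).
have uK x : cancel (u x) (v x).
  by move=> [j e]; rewrite /u /v; case: (x == s); rewrite /= ?aK ?addrK.
have vK x : cancel (v x) (u x).
  by move=> [j e]; rewrite /u /v; case: (x == s); rewrite /= ?bK ?subrK.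
have [phi aphi phiX] := free_basis_action sG freeG uK vK.
exists phi; split=> // j e.
  by rewrite phiX; [rewrite /u eqxx | left].
by rewrite phiX; [rewrite /u free_pair_neq | right].
Qed.

Lemma level_action_conj (E : Type) (a : int -> E -> E) phi e :
  action_on G phi ->
  (forall j e, phi s (j, e) = (j, a j e)) ->
  (forall j e, phi t (j, e) = ((j + 1)%R, e)) ->
  phi (s ^ t^-1) (0%R, e) = (0%R, a (-1)%R e).
Proof.
move=> aphi phis phit; have [_ GM GV] := sG.
have GtV : G t^-1 by exact: GV.
have phitV : phi t^-1 (0%R, e) = ((-1)%R, e).
  by apply: (can_inj (actionK sG aphi Gt)); rewrite (actionVK sG aphi Gt) phit.
rewrite conjgE invgK !(actionM aphi) //; last exact: GM.
by rewrite phitV phis phit.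
Qed.

Lemma sub_conj_pair : generated [set s; s ^ t^-1] `<=` G.
Proof.
apply: (generated_min sG) => x [] -> //.
have [_ _ GV] := sG; apply: (subgroupJ sG Gs); exact: GV.
Qed.

(** At level [0], the elements [s] and [s ^ t^-1] act as the two ping-pong
shears, so a reduced word in them is determined by its value. *)
Theorem free_conj_pair :
  free_basis (generated [set s; s ^ t^-1]) [set s; s ^ t^-1].
Proof.
set s' := s ^ t^-1.
have s's : (s' == s) = false.
  by apply/eqP => E; apply: st_nc; rewrite (conjgCV t s) -/s' E.
apply: free_basisI => w1 w2 X1 X2 r1 r2 E12.
apply: (shear_word_inj X1 X2 r1 r2).
pose lev (j : int) := if j == 0%R then s else s'.
pose a (j : int) := shear s (3%:R : int)%R (lev j).
have [phi [aphi phis phit]] := @level_action _ a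
  (fun j => shear s (- 3%:R)%R (lev j))
  (fun j => shearK _ _ _) (fun j => shearNK _ _ _).
have phis' := level_action_conj _ aphi phis phit.
have HG := sub_conj_pair; have sH := generated_subgroup [set s; s'].
have phiE w : letters_in [set s; s'] w ->
   phi (word_val w) (0%R, (1, 1)%R) = (0%R, shear_word int s w).
  rewrite /shear_word; elim: w => [|l w IH].
    by rewrite word_val_nil (action1 aphi).
  move=> /letters_in_cons[Xl Xw].
  have Hl : generated [set s; s'] l.1 by exact: sub_generated.
  have Gw : G (word_val w).
    by apply: HG; apply: subgroup_word_val (@sub_generated _ _) Xw.
  have [_ _ GV] := sG.
  have phil p : phi l.1 (0%R, p) = (0%R, shear s (3%:R)%R l.1 p).
    by case: Xl => ->; rewrite ?phis ?phis' /a /lev ?eqxx.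
  rewrite word_val_cons (actionM aphi) ?IH //; last first.
    by rewrite /letter_val; case: l.2; [apply: GV|]; exact: HG.
  rewrite /letter_val /= /act_letter; case: l.2; last exact: phil.
  apply: (can_inj (actionK sG aphi (HG _ Hl))).
  by rewrite (actionVK sG aphi (HG _ Hl)) phil shearNK.
by have := phiE _ X1; rewrite E12 phiE // => -[].
Qed.

End FreePair.

Section Retraction.
Variables (gT : groupType) (s t : gT).
Implicit Types (g h x y : gT) (w : seq (letter gT)).
Local Open Scope group_scope.
Local Open Scope classical_set_scope.

Local Notation G := (generated [set s; t]).
Local Notation s' := (s ^ t^-1).
Local Notation H := (generated [set s; s']).
Hypotheses (freeG : free_basis G [set s; t]) (st_nc : s * t <> t * s).

Let sG : subgroup G := generated_subgroup _.
Let Gs : G s. Proof. by apply: sub_generated; left. Qed.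
Let Gt : G t. Proof. by apply: sub_generated; right. Qed.

(** The conjugate [t^(-j) s t^j] if it is one of the two chosen generators of
[H], and [1] otherwise: the image of this conjugate under the retraction of the
kernel of the [t]-exponent onto [H]. *)
Definition level_elt (j : int) : gT :=
  if j == 0%R then s else if j == (-1)%R then s' else 1.

Lemma level_elt_in j : H (level_elt j).
Proof.
have [H1 _ _] := generated_subgroup [set s; s'].
rewrite /level_elt; case: eqP => _; first by apply: sub_generated; left.
by case: eqP => _ //; apply: sub_generated; right.
Qed.

(** The induced action on [Z * G] whose level [0] extends the left translations
by [H].  Every element of [G] translates the levels by its [t]-exponent and
multiplies each fibre on the left by an element of [H]. *)
Lemma translation_action : exists phi : gT -> int * gT -> int * gT,
  [/\ action_on G phi,
      forall h, H h -> forall y, phi h (0%R, y) = (0%R, h * y),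
      forall k j y, phi (expgz s k) (j, y) = (j, expgz (level_elt j) k * y),
      forall k j y, phi (expgz t k) (j, y) = ((j + k)%R, y) &
      forall g, G g -> exists e, forall j, exists2 c, H c &
        forall y, phi g (j, y) = ((j + e)%R, c * y)].
Proof.
have [phi [aphi phis phit]] := level_action freeG st_nc
  (fun j => mulKg (level_elt j)) (fun j => mulVKg (level_elt j)).
have sH := generated_subgroup [set s; s']; have [H1 HM HV] := sH.
have HG := @sub_conj_pair gT s t; have [G1 GM GV] := sG.
exists phi; split=> //.
- have sP : subgroup [set h | G h /\ forall y, phi h (0%R, y) = (0%R, h * y)].
    split=> [|g h [Gg phig] [Gh phih]|g [Gg phig]]; split; rewrite ?mul1g //=.
    + by move=> y; rewrite mul1g (action1 aphi).
    + exact: GM.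
    + by move=> y; rewrite (actionM aphi) // phih phig mulgA.
    + exact: GV.
    + move=> y; apply: (can_inj (actionK sG aphi Gg)).
      by rewrite (actionVK sG aphi Gg) phig mulVKg.
  suff HP : H `<=` [set h | G h /\ forall y, phi h (0%R, y) = (0%R, h * y)].
    by move=> h /HP[].
  apply: generated_min => // x xss; split.
    by apply: HG; exact: sub_generated.
  case: xss => -> y; first by rewrite phis.
  by rewrite (level_action_conj _ aphi phis phit).
- have pos n j y : phi (s ^+ n) (j, y) = (j, level_elt j ^+ n * y).
    elim: n y => [|n IH] y; first by rewrite !expg0 (action1 aphi) mul1g.
    by rewrite !expgS (actionM aphi) ?IH ?phis ?mulgA //; exact: (subgroupX _ sG).
  case=> n j y /=; first exact: pos.
  have Gn := subgroupX n.+1 sG Gs.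
  apply: (can_inj (actionK sG aphi Gn)).
  by rewrite (actionVK sG aphi Gn) pos mulVKg.
- have pos n j y : phi (t ^+ n) (j, y) = ((j + n%:Z)%R, y).
    elim: n y => [|n IH] y; first by rewrite !expg0 (action1 aphi) addr0.
    rewrite !expgS (actionM aphi) ?IH ?phit ?intS //; last exact: (subgroupX _ sG).
    by rewrite -addrA [(n%:Z + 1)%R]addrC.
  case=> n j y /=; first exact: pos.
  have Gn := subgroupX n.+1 sG Gt.
  apply: (can_inj (actionK sG aphi Gn)).
  by rewrite (actionVK sG aphi Gn) pos NegzE subrK.
- have sP : subgroup [set g | G g /\ exists e, forall j, exists2 c, H c &
      forall y, phi g (j, y) = ((j + e)%R, c * y)].
    split=> [|g h [Gg [e pg]] [Gh [f ph]]|g [Gg [e pg]]]; split => //=.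
    + exists 0%R => j; exists 1 => // y.
      by rewrite (action1 aphi) addr0 mul1g.
    + exact: GM.
    + exists (f + e)%R => j; have [c Hc pc] := ph j.
      have [c' Hc' pc'] := pg (j + f)%R; exists (c' * c); first exact: HM.
      by move=> y; rewrite (actionM aphi) // pc pc' addrA mulgA.
    + exact: GV.
    + exists (- e)%R => j; have [c Hc pc] := pg (j - e)%R.
      exists c^-1; first exact: HV.
      move=> y; apply: (can_inj (actionK sG aphi Gg)).
      by rewrite (actionVK sG aphi Gg) pc subrK mulVKg.
  suff GP : G `<=` [set g | G g /\ exists e, forall j, exists2 c, H c &
      forall y, phi g (j, y) = ((j + e)%R, c * y)].
    by move=> g /GP[].
  apply: generated_min => // x [] ->; split=> //.
    exists 0%R => j; exists (level_elt j); first exact: level_elt_in.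
    by move=> y; rewrite phis addr0.
  by exists 1%R => j; exists 1 => // y; rewrite phit mul1g.
Qed.

(** Elements of [H] preserve the level [0], whereas a conjugate of [t^k] shifts
every level by [k]. *)
Lemma conj_t_notin x k : G x -> H (expgz t k ^ x) -> expgz t k ^ x = 1.
Proof.
have [phi [aphi phiH _ phit phiG]] := translation_action.
move=> Gx Hh; set h := _ ^ x in Hh *; have [G1 GM GV] := sG.
have Gh := sub_conj_pair Hh.
have Gtk := subgroup_expgz k sG Gt.
have [e Pe] := phiG _ Gx; have [c _ pc] := Pe 0%R.
have E : x * h = expgz t k * x by rewrite /h conjgE mulVKg.
have : phi (x * h) (0%R, 1) = phi (expgz t k * x) (0%R, 1) by rewrite E.
rewrite (actionM aphi _ Gx Gh) (actionM aphi _ Gtk Gx) (phiH _ Hh) !pc.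
rewrite phit => -[+ _].
rewrite -{1}[(0 + e)%R]addr0 => /addrI k0.
by rewrite /h -k0 /= conj1g.
Qed.

(** Let [x] map [(0, 1)] to [(e, c)] with [c] in [H], and let [h] be the conjugate
of [s^k] by [x].  Comparing the two sides of [x h = s^k x] at [(0, 1)] gives
[c h = u^k c] in [H], where [u] is the element by which [s] acts at level [e].
If that element is [1], then [h] is trivial. *)
Lemma conj_s_retract x k : G x -> H (expgz s k ^ x) -> expgz s k ^ x <> 1 ->
  exists c u, [/\ H c, u = s \/ u = s' & (expgz s k ^ x) ^ c = expgz u k].
Proof.
have [phi [aphi phiH phis _ phiG]] := translation_action.
move=> Gx Hh; set h := _ ^ x in Hh * => h1; have [G1 GM GV] := sG.
have Gh := sub_conj_pair Hh.
have Gsk := subgroup_expgz k sG Gs.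
have [e Pe] := phiG _ Gx; have [c Hc pc] := Pe 0%R.
have E : x * h = expgz s k * x by rewrite /h conjgE mulVKg.
have : phi (x * h) (0%R, 1) = phi (expgz s k * x) (0%R, 1) by rewrite E.
rewrite (actionM aphi _ Gx Gh) (actionM aphi _ Gsk Gx) (phiH _ Hh) !pc.
rewrite phis !mulg1 => -[Ec].
have {Ec} Ec : h ^ c^-1 = expgz (level_elt (0 + e)) k.
  by rewrite conjgE invgK mulgA Ec mulgK.
have [_ _ HV] := generated_subgroup [set s; s'].
exists c^-1, (level_elt (0 + e)); split=> //; first exact: HV.
move: Ec; rewrite /level_elt; case: eqP => _; first by left.
case: eqP => _; first by right.
by rewrite expg1z => /eqP; rewrite conjg_eq1 => /eqP.
Qed.

End Retraction.

(** * Roots in free groups *)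

Section Roots.
Variable gT : groupType.
Implicit Types (g h x y : gT) (G X : set gT) (l k : letter gT)
  (w : seq (letter gT)).
Local Open Scope group_scope.
Local Open Scope classical_set_scope.

Let adj l k : bool := ~~ ((l.1 == k.1) && (l.2 != k.2)).

(** A reduced word is [v c v^-1] with [c] cyclically reduced, and its [p]-th power
reduces to [v c^p v^-1].  The induction strips one letter at each end; it needs
that the power begins and ends with the same letters as the word itself. *)
Lemma reduced_power X l u p : letters_in X (l :: u) -> reduced (l :: u) ->
  (0 < p)%N ->
  exists u', [/\ letters_in X (l :: u'), reduced (l :: u'),
    last l u' = last l u, (p <= size (l :: u'))%N &
    word_val (l :: u') = word_val (l :: u) ^+ p].
Proof.
have [n] := ubnP (size u); elim: n l u => [//|n IH] l u ltun Xu ru p_gt0.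
have [cyc|ncyc] := boolP (adj (last l u) l).
  elim: p p_gt0 {IH} => [//|[|p] IHp] _; first by exists u; split.
  have [//|u' [Xu' ru' lu' su' vu']] := IHp.
  exists (u ++ l :: u'); split.
  - exact: letters_in_cat Xu Xu'.
  - rewrite /reduced /= cat_path; apply/andP; split=> //.
    by rewrite /= -[X in X && _]/(adj _ _) cyc.
  - by rewrite last_cat.
  - by move: su' => /=; rewrite size_cat /=; lia.
  - by rewrite -cat_cons word_val_cat vu' expgSS.
have adj_sym k : adj l k = adj k l.
  by rewrite /adj [l.1 == _]eq_sym [l.2 == _]eq_sym.
case/lastP: u ltun Xu ru ncyc => [|v k]; first by rewrite /adj /= !eqxx.
rewrite last_rcons -adj_sym; case: v => [|m v] ltvn Xv.
  by rewrite /reduced /= -/(adj l k) => /andP[->].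
rewrite /reduced rcons_cons /= rcons_path => /and3P[lm rv vk] nlk.
have [Xl Xmv] : X l.1 /\ letters_in X (m :: v).
  split=> [|j jv]; apply: Xv; first by rewrite mem_head.
  by rewrite in_cons mem_rcons in_cons jv !orbT.
have Xk : X k.1 by apply: Xv; rewrite in_cons mem_rcons mem_head orbT.
have [|v' [Xv' rv' lv' sv' vv']] := IH m v _ Xmv rv p_gt0.
  by move: ltvn; rewrite size_rcons /=; lia.
have lkV : letter_val l = (letter_val k)^-1.
  move: nlk; rewrite /adj negbK /letter_val => /andP[/eqP ->].
  by case: l.2; case: k.2 => // _; rewrite invgK.
have sandwich w : word_val (l :: rcons w k) = word_val w ^ letter_val k.
  by rewrite word_val_cons -cats1 word_val_cat (word_val_cons k [::])
    word_val_nil mulg1 lkV conjgE.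
exists (rcons (m :: v') k); split.
- apply/letters_in_cons; split=> //; rewrite -cats1.
  apply: letters_in_cat => //.
  by move=> j; rewrite inE => /eqP->.
- by rewrite /reduced rcons_cons /= rcons_path lv' lm vk /= andbT.
- by rewrite !last_rcons.
- by apply: leq_trans sv' _; rewrite /= size_rcons ltnW.
- by rewrite !sandwich vv' conjXg -(sandwich (m :: v)).
Qed.

Lemma free_power_bound G X h : free_basis G X -> G h -> h <> 1 ->
  exists N, forall g n, G g -> h = g ^+ n -> (n <= N)%N.
Proof.
move=> [XG fG] Gh h1; have [w [_ wuniq]] := fG _ Gh.
exists (size w) => g [//|n] Gg hE; have [u [[Xu ru vu] _]] := fG _ Gg.
case: u Xu ru vu => [|l u] Xu ru vu.
  by case: h1; rewrite hE -vu word_val_nil expg1n.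
have [u' [Xu' ru' _ su' vu']] := reduced_power Xu ru (ltn0Sn n).
by rewrite (wuniq (l :: u')) //; split=> //; rewrite vu' vu.
Qed.

Definition primitive G g : Prop :=
  forall x (m : int), G x -> g = expgz x m -> m = 1%R \/ m = (-1)%R.

(** The exponents [n] for which [h] is an [n]-th power are bounded by the length of
[h]; the root with the largest exponent is primitive. *)
Theorem free_root G X h : subgroup G -> free_basis G X -> G h -> h <> 1 ->
  exists g n, [/\ G g, h = g ^+ n & primitive G g].
Proof.
move=> sG fG Gh h1; have [N hN] := free_power_bound fG Gh h1.
pose P n := `[< exists2 g, G g & h = g ^+ n >].
have exP : exists n, P n by exists 1%N; apply/asboolP; exists h.
have leP n : P n -> (n <= N)%N by move=> /asboolP[g Gg hE]; exact: hN Gg hE.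
case: (ex_maxnP exP leP) => n /asboolP[g Gg hE] maxn.
have n_gt0 : (0 < n)%N by case: n hE {maxn} => // hE; case: h1.
exists g, n; split=> // x m Gx gE.
have E : h = expgz x (m * n%:Z)%R by rewrite hE gE -expgzM.
have [_ _ GV] := sG.
have m_neq0 : m <> 0%R by move=> m0; apply: h1; rewrite E m0 mul0r.
have : P (`|m| * n)%N.
  apply/asboolP; case: (m) E => q Eq.
    by exists x => //; rewrite Eq -PoszM.
  exists x^-1; first exact: GV.
  by rewrite Eq NegzE mulNr expgzN -PoszM expVgn.
move=> /maxn; rewrite -{2}[n]mul1n leq_pmul2r //; lia.
Qed.

End Roots.

(** * Parabolic elements of PSL(2) *)

Section PSL2Theory.
Variable F : fieldType.
Local Open Scope ring_scope.
Implicit Types (A B : 'M[F]_2) (l : F).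

Lemma mx2_eta A : A = mx2 (A 0 0) (A 0 1) (A 1 0) (A 1 1).
Proof.
by apply/matrixP => -[[|[|//]] i2] [[|[|//]] j2];
  rewrite mxE /=; congr (A _ _); exact: val_inj.
Qed.

Lemma mx2_inj (a b c d a' b' c' d' : F) :
  mx2 a b c d = mx2 a' b' c' d' -> [/\ a = a', b = b', c = c' & d = d'].
Proof.
by move=> /matrixP E; split;
  [have := E 0 0 | have := E 0 1 | have := E 1 0 | have := E 1 1]; rewrite !mxE.
Qed.

Lemma mul_mx2 (a b c d a' b' c' d' : F) :
  mx2 a b c d *m mx2 a' b' c' d' =
  mx2 (a * a' + b * c') (a * b' + b * d') (c * a' + d * c') (c * b' + d * d').
Proof.
rewrite [LHS]mx2_eta; congr mx2;
  by rewrite !mxE !big_ord_recl big_ord0 !mxE /= addr0.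
Qed.

Lemma add_mx2 (a b c d a' b' c' d' : F) :
  mx2 a b c d + mx2 a' b' c' d' = mx2 (a + a') (b + b') (c + c') (d + d').
Proof. by rewrite [LHS]mx2_eta !mxE. Qed.

Lemma scale_mx2 (u a b c d : F) :
  u *: mx2 a b c d = mx2 (u * a) (u * b) (u * c) (u * d).
Proof. by rewrite [LHS]mx2_eta !mxE. Qed.

Lemma opp_mx2 (a b c d : F) : - mx2 a b c d = mx2 (- a) (- b) (- c) (- d).
Proof. by rewrite [LHS]mx2_eta !mxE. Qed.

Lemma scalar_mx2 (v : F) : v%:M = mx2 v 0 0 v.
Proof. by rewrite [LHS]mx2_eta !mxE. Qed.

Lemma tr_mx2 (a b c d : F) : \tr (mx2 a b c d) = a + d.
Proof. by rewrite /mxtrace !big_ord_recl big_ord0 !mxE addr0. Qed.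

Definition mx2E :=
  (scalar_mx2, scale_mx2, mul_mx2, add_mx2, opp_mx2, tr_mx2, det_mx2).

Lemma Cayley_Hamilton2 A : A *m A = \tr A *: A - (\det A)%:M.
Proof. by rewrite (mx2_eta A) !mx2E; congr mx2; ring. Qed.

(** The discriminant of the characteristic polynomial is the squared difference of
the eigenvalues, hence is invariant under the addition of scalars and quadratic
under scaling. *)
Lemma discr_affine A u v :
  (\tr (u *: A + v%:M)) ^+ 2 - 4%:R * \det (u *: A + v%:M) =
  u ^+ 2 * ((\tr A) ^+ 2 - 4%:R * \det A).
Proof. by rewrite (mx2_eta A) !mx2E; ring. Qed.

Lemma SL2_expg_affine (A : SL2 F) n :
  exists u v, (A ^+ n)%g = u *: (A : 'M_2) + v%:M :> 'M_2.
Proof.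
elim: n => [|n [u [v IH]]].
  by exists 0, 1; rewrite scale0r add0r.
exists (u * \tr A + v), (- u); rewrite expgS.
rewrite -[LHS]/(SL2_val A *m SL2_val (A ^+ n)%g) IH mulmxDr -scalemxAr.
rewrite Cayley_Hamilton2 det_SL2 mul_mx_scalar scalerBr scalerA scale_scalar_mx.
by rewrite mulr1 addrAC -scalerDl raddfN.
Qed.

Lemma PSL2_of_expg (A : SL2 F) n : PSL2_of (A ^+ n)%g = (PSL2_of A ^+ n)%g.
Proof. by elim: n => [//|n IH]; rewrite !expgS PSL2_ofM IH. Qed.

Lemma PSL2_of_scalar (A : SL2 F) v : SL2_val A = v%:M -> PSL2_of A = 1%g.
Proof.
move=> Av; have := det_SL2 A; rewrite Av det_scalar => /eqP.
rewrite sqrf_eq1 => /orP[] /eqP v1; apply/eq_PSL2_of; [left|right];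
  by apply: val_inj; rewrite /= Av v1 ?raddfN.
Qed.

(** By Cayley-Hamilton a power of [A] has the form [u A + v].  It is parabolic, so
its discriminant [u^2 (tr A ^ 2 - 4)] vanishes while [u <> 0]. *)
Lemma parabolic_root (g : PSL2 F) n : parabolic (g ^+ n)%g -> parabolic g.
Proof.
rewrite -[g]PSL2_reprK; move: (PSL2_repr g) => A; rewrite -PSL2_of_expg.
move=> /parabolic_of[An1 trAn]; apply/parabolic_of; split.
  by move=> A1; apply: An1; rewrite PSL2_of_expg A1 expg1n.
have [u [v E]] := SL2_expg_affine A n.
have := discr_affine A u v; rewrite -E trAn !det_SL2 mulr1 subrr => /esym/eqP.
rewrite mulf_eq0 expf_eq0 /= subr_eq0 => /orP[/eqP u0|/eqP -> //].
by case: An1; apply: (PSL2_of_scalar (v := v)); rewrite E u0 scale0r add0r.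
Qed.

Lemma S_parabolic : parabolic (PSL2_of (S_mx F)).
Proof.
apply/parabolic_of; split; last by rewrite /= !mx2E; ring.
rewrite -PSL2_of1 => /eq_PSL2_of[] /(congr1 (@SL2_val F)) /=;
  rewrite !mx2E => /mx2_inj[_ _ /eqP]; by rewrite ?oppr0 oner_eq0.
Qed.

Lemma T_parabolic l : 2%:R != 0 :> F -> l != 0 -> parabolic (PSL2_of (T_mx l)).
Proof.
move=> two_neq0 l0; apply/parabolic_of; split; last by rewrite /= !mx2E; ring.
rewrite -PSL2_of1 => /eq_PSL2_of[] /(congr1 (@SL2_val F)) /=;
  rewrite !mx2E => /mx2_inj[_ /eqP]; 
  by rewrite ?oppr0 mulf_eq0 (negPf two_neq0) (negPf l0).
Qed.

Lemma ST_noncommuting l : 2%:R != 0 :> F -> l != 0 ->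
  (PSL2_of (S_mx F) * PSL2_of (T_mx l))%g <>
  (PSL2_of (T_mx l) * PSL2_of (S_mx F))%g.
Proof.
move=> two_neq0 l0; rewrite -!PSL2_ofM.
move=> /eq_PSL2_of[] /(congr1 (@SL2_val F)) /=; rewrite !mx2E => /mx2_inj[].
  move=> /eqP + _ _ _; rewrite !(mul1r, mulr1, mul0r, mulr0, addr0).
  rewrite -subr_eq0 opprD addrA.
  by rewrite subrr add0r oppr_eq0 mulf_eq0 (negPf two_neq0) (negPf l0).
move=> _ _ /eqP + _; rewrite !(mul1r, mulr1, mul0r, mulr0, addr0, add0r).
by rewrite -subr_eq0 opprK (negPf two_neq0).
Qed.

Fact N_subproof (k : F) : \det (mx2 1 0 k 1) == 1.
Proof. by rewrite det_mx2 mul0r subr0 mulr1. Qed.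

Definition N_mx (k : F) : SL2 F := MkSL2 (N_subproof k).

Lemma S_conj_N k : (PSL2_of (S_mx F) ^ PSL2_of (N_mx k) = PSL2_of (S_mx F))%g.
Proof.
apply: (mulgI (PSL2_of (N_mx k))); rewrite conjgE mulVKg -!PSL2_ofM.
congr (PSL2_of _); apply: val_inj; rewrite /= !mx2E; congr mx2; ring.
Qed.

(** The lower unipotent matrix with entry [- 1 / (2 l)] sends [0] to [0] and [2 l],
the fixed point of [s ^ t^-1], to infinity. *)
Lemma T_conj_N l : 2%:R != 0 :> F -> l != 0 ->
  (PSL2_of (T_mx (f_quad l)) ^ PSL2_of (N_mx (- (2%:R * l)^-1)) =
   PSL2_of (S_mx F) ^ (PSL2_of (T_mx l))^-1)%g.
Proof.
move=> two_neq0 l0; set N := PSL2_of (N_mx _); set T := PSL2_of (T_mx l).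
apply: (mulgI N); rewrite conjgE mulVKg conjgE invgK !mulgA.
apply: (mulIg T); rewrite mulgVK /T /N.
rewrite -(PSL2_ofM (T_mx _) (N_mx _)) -(PSL2_ofM (N_mx _) (T_mx _)) -!PSL2_ofM.
congr (PSL2_of _); apply: val_inj; rewrite /= !mx2E /f_quad.
by congr mx2; field; rewrite l0 two_neq0.
Qed.

End PSL2Theory.

(** * Ascent of freeness and of parabolic dust *)

Section Conj.
Variable gT : groupType.
Implicit Types (g h x y s t m : gT) (X : set gT).
Local Open Scope group_scope.
Local Open Scope classical_set_scope.

Lemma generated_conj X m x : generated X x ->
  generated [set z ^ m | z in X] (x ^ m).
Proof.
set Y := (X in generated X (_ ^ _)); have [Y1 YM YV] := generated_subgroup Y.
have sP : subgroup [set x | generated Y (x ^ m)].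
  split=> /= [|y z Yy Yz|y Yy]; rewrite ?conj1g ?conjMg ?conjVg //.
    exact: YM.
  exact: YV.
by apply: (generated_min sP) => z Xz; apply: sub_generated; exists z.
Qed.

Lemma generated_conjV X m x : generated [set z ^ m | z in X] x ->
  generated X (x ^ m^-1).
Proof.
have [X1 XM XV] := generated_subgroup X.
have sP : subgroup [set x | generated X (x ^ m^-1)].
  split=> /= [|y z Yy Yz|y Yy]; rewrite ?conj1g ?conjMg ?conjVg //.
    exact: XM.
  exact: XV.
apply: (generated_min sP) => _ [z Xz <-] /=; rewrite conjgK.
exact: sub_generated.
Qed.

Lemma free_basis_conj X m :
  free_basis (generated [set z ^ m | z in X]) [set z ^ m | z in X] ->
  free_basis (generated X) X.
Proof.
move=> [_ fX]; pose c (l : letter gT) : letter gT := (l.1 ^ m, l.2).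
have c_inj : injective c by move=> [x b] [y d] [/conjg_inj -> ->].
have valc w : word_val (map c w) = word_val w ^ m.
  elim: w => [|[x b] w IH]; first by rewrite !word_val_nil conj1g.
  rewrite /= !word_val_cons IH conjMg /letter_val /=.
  by case: b; rewrite ?conjVg.
have inc w : letters_in X w -> letters_in [set z ^ m | z in X] (map c w).
  by move=> Xw _ /mapP[l /Xw Xl ->]; exists l.1.
have redc w : reduced (map c w) = reduced w.
  rewrite /reduced sorted_map; apply: eq_sorted => l k /=.
  by rewrite (inj_eq (@conjg_inj _ m)).
apply: free_basisI => w1 w2 X1 X2 r1 r2 E.
have [|w [_ wuniq]] := fX (word_val (map c w1)).
  by apply: subgroup_word_val (@sub_generated _ _) (inc _ X1);
    exact: generated_subgroup.
have w1E : w = map c w1 by apply: wuniq; split; [exact: inc | rewrite redc |].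
have w2E : w = map c w2.
  by apply: wuniq; split; [exact: inc | rewrite redc | rewrite !valc E].
by apply: (inj_map c_inj); rewrite -w1E -w2E.
Qed.

(** Pigeonhole: if each of three elements were conjugate to [u] or [v], two of them
would be conjugate to each other. *)
Lemma three_classes_avoid_two G (P : gT -> Prop) u v : subgroup G ->
  (exists h1 h2 h3, [/\ P h1, P h2 & P h3] /\
    [/\ ~ conj_cyclic G h1 h2, ~ conj_cyclic G h1 h3 & ~ conj_cyclic G h2 h3]) ->
  exists h, [/\ P h, ~ conj_cyclic G h u & ~ conj_cyclic G h v].
Proof.
move=> sG [h1 [h2 [h3 [[P1 P2 P3] [n12 n13 n23]]]]].
apply: contrapT => no.
have cls h : P h -> conj_cyclic G h u \/ conj_cyclic G h v.
  move=> Ph; apply: contrapT => /not_orP[nu nv]; apply: no.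
  by exists h.
have same w h k : conj_cyclic G h w -> conj_cyclic G k w -> conj_cyclic G h k.
  move=> hw kw; apply: conj_cyclic_trans hw _ => //.
  exact: conj_cyclic_sym.
case: (cls _ P1) (cls _ P2) (cls _ P3) => c1 [] c2 [] c3.
- exact: n12 (same _ _ _ c1 c2).
- exact: n12 (same _ _ _ c1 c2).
- exact: n13 (same _ _ _ c1 c3).
- exact: n23 (same _ _ _ c2 c3).
- exact: n23 (same _ _ _ c2 c3).
- exact: n13 (same _ _ _ c1 c3).
- exact: n12 (same _ _ _ c1 c2).
- exact: n12 (same _ _ _ c1 c2).
Qed.

Section Basis.
Variables s t : gT.
Local Notation G := (generated [set s; t]).
Hypotheses (freeG : free_basis G [set s; t]) (st_nc : s * t <> t * s).

(** If [s = g^k], then [k] divides the exponent sum of [s] in [s], which is [1]. *)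
Lemma basis_primitive : primitive G s.
Proof.
have [eps [epsM epss _]] := exponent_sum freeG st_nc.
move=> g k Gg /(congr1 eps); rewrite epss (exponent_expgz _ epsM Gg).
move=> /(congr1 absz)/esym/eqP.
by rewrite abszM muln_eq1 => /andP[/eqP k1 _]; lia.
Qed.

Lemma basis_not_conj : ~ conj_cyclic G s t.
Proof.
have [eps [epsM epss epst]] := exponent_sum freeG st_nc.
have sG := generated_subgroup [set s; t].
have Gs : G s by apply: sub_generated; left.
have Gt : G t by apply: sub_generated; right.
move=> /conj_cyclicP[g [a [b [Gg E _]]]]; move/(congr1 eps): (conjgC s g).
rewrite E !epsM //; last exact: (subgroup_expgz a sG Gt).
by rewrite (exponent_expgz _ epsM Gt) epss epst; lia.
Qed.

End Basis.

Lemma free_basis_swap s t : free_basis (generated [set s; t]) [set s; t] ->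
  free_basis (generated [set t; s]) [set t; s].
Proof. by rewrite [in X in X -> _]setUC. Qed.

End Conj.

Section Dust.
Variable F : fieldType.
Hypothesis two_neq0 : (2%:R != 0 :> F)%R.
Local Open Scope group_scope.
Local Open Scope classical_set_scope.
Implicit Types l : F.

Lemma parabolic_conj (x y : PSL2 F) : parabolic x -> parabolic (x ^ y).
Proof.
rewrite -[x]PSL2_reprK -[y]PSL2_reprK.
move: (PSL2_repr x) (PSL2_repr y) => A B /parabolic_of[A1 trA].
rewrite conjgE -PSL2_ofV -(PSL2_ofM A B) -(PSL2_ofM B^-1).
apply/parabolic_of; split.
  by rewrite !PSL2_ofM PSL2_ofV -conjgE => /eqP; rewrite conjg_eq1 => /eqP.
rewrite -trA -[SL2_val _]/(invmx B *m (A *m B))%R.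
by rewrite mxtrace_mulC mulmxK ?SL2_unit.
Qed.

Local Notation S := (PSL2_of (S_mx F)).
Local Notation T l := (PSL2_of (T_mx l)).

Lemma G_f_quad_conj l : l != 0%R ->
  [set z ^ PSL2_of (N_mx (- (2%:R * l)^-1)%R) | z in [set S; T (f_quad l)]] =
  [set S; S ^ (T l)^-1].
Proof.
move=> l0; have ST := T_conj_N two_neq0 l0.
have SN := S_conj_N (- (2%:R * l)^-1)%R.
apply/seteqP; split=> z.
  by move=> [_ [] -> <-]; [left | right].
by move=> [] ->; [exists S; [left|] | exists (T (f_quad l)); [right|]].
Qed.

Lemma f_quad_neq0 l : l != 0%R -> f_quad l != 0%R.
Proof. by move=> l0; rewrite /f_quad mulf_neq0 ?oppr_eq0 ?expf_neq0. Qed.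

Lemma free_f_quad l : l != 0%R ->
  free_group (G_ l) -> free_group (G_ (f_quad l)).
Proof.
move=> l0 fG; have st_nc := ST_noncommuting two_neq0 l0.
have := free_conj_pair (free_pair fG st_nc) st_nc; rewrite -(G_f_quad_conj l0).
by move=> /free_basis_conj fX; exists [set S; T (f_quad l)].
Qed.

Lemma dust_f_quad l : l != 0%R -> free_group (G_ l) ->
  parabolic_dust (G_ (f_quad l)) -> parabolic_dust (G_ l).
Proof.
move=> l0 fG dust; have st_nc := ST_noncommuting two_neq0 l0.
have freeG := free_pair fG st_nc; rewrite /G_ in dust *.
set s := S in freeG st_nc dust *; set t := T l in freeG st_nc dust *.
set t' := T _ in dust.
pose m := PSL2_of (N_mx (- (2%:R * l)^-1)%R).
have sm : s ^ m = s by exact: S_conj_N.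
have tm : t' ^ m = s ^ t^-1 by exact: T_conj_N.
have conjE := G_f_quad_conj l0.
have sG := generated_subgroup [set s; t].
have sG' := generated_subgroup [set s; t'].
have [h [[Gh ph prh] hns hnt]] := three_classes_avoid_two s t' sG' dust.
have Hhm : generated [set s; s ^ t^-1] (h ^ m).
  by rewrite -conjE; exact: generated_conj.
have Ghm := sub_conj_pair Hhm.
have phm := parabolic_conj m ph; have [hm1 _] := phm.
have [g [n [Gg hE prg]]] := free_root sG freeG Ghm hm1.
have pg : parabolic g by apply: (parabolic_root (n := n)); rewrite -hE.
(* If [h] is conjugate to [u^k] in [<s, t'>], then [k = 1] or [k = -1], because
   [h] is primitive there. *)
have conj_gen u c k : generated [set s; t'] u ->
    generated [set s; s ^ t^-1] c ->
    (h ^ m) ^ c = expgz (u ^ m) k -> conj_cyclic (generated [set s; t']) h u.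
  move=> Gu Hc E; have Gc : generated [set s; t'] (c ^ m^-1).
    by apply: generated_conjV; rewrite conjE.
  have {}E : h ^ (c ^ m^-1) = expgz u k.
    by apply: (@conjg_inj _ m); rewrite -expgzJ -E conjJg conjgKV.
  apply: (conj_cyclic_expgz Gc _ E).
  apply: (prh (u ^ (c ^ m^-1)^-1) k); last by rewrite expgzJ -E conjgK.
  by have [_ _ GV] := sG'; apply: (subgroupJ sG' Gu); exact: GV.
have Gs : generated [set s; t] s by apply: sub_generated; left.
have Gt : generated [set s; t] t by apply: sub_generated; right.
exists s, t, g; split; split.
- split=> //; first exact: S_parabolic.
  exact: basis_primitive freeG st_nc.
- split=> //; first exact: T_parabolic.
  have := basis_primitive (free_basis_swap freeG) (nesym st_nc).
  by rewrite [in X in X -> _]setUC.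
- by split.
- exact: basis_not_conj freeG st_nc.
- move=> /conj_cyclicP[x [_ [b [Gx _ gE]]]].
  have hmE : h ^ m = expgz s (b * n%:Z)%R ^ x.
    by rewrite hE gE -expgzM -conjXg.
  rewrite hmE in Hhm hm1.
  have [c [u [Hc us E]]] := conj_s_retract freeG st_nc Gx Hhm hm1.
  rewrite -hmE in E; case: us E => ->; [rewrite -{1}sm | rewrite -tm] => E.
    by apply: hns; apply: conj_gen Hc E; apply: sub_generated; left.
  by apply: hnt; apply: conj_gen Hc E; apply: sub_generated; right.
- move=> /conj_cyclicP[x [_ [b [Gx _ gE]]]].
  have hmE : h ^ m = expgz t (b * n%:Z)%R ^ x.
    by rewrite hE gE -expgzM -conjXg.
  by apply: hm1; rewrite hmE in Hhm *; exact: (conj_t_notin freeG st_nc Gx Hhm).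
Qed.

End Dust.

Local Open Scope ring_scope.

Theorem theorem7p1 (R : realType) (lambda : R[i]%C) (lambda_neq0 : lambda != 0) :
  ((exists n : nat, parabolic_dust (G_ (iter n (@f_quad _) lambda))) ->
     parabolic_dust (G_ lambda) \/ ~ free_group (G_ lambda)) /\
  ((exists n : nat, ~ free_group (G_ (iter n (@f_quad _) lambda))) ->
     ~ free_group (G_ lambda)).
Proof.
have two_neq0 : 2%:R != 0 :> R[i]%C by rewrite pnatr_eq0.
split=> [[n dust]|[n nfree] fG].
  have [fG|] := pselect (free_group (G_ lambda)); [left|by right].
  elim: n lambda lambda_neq0 dust fG => [//|n IH] l l0.
  rewrite iterSr => dust fG.
  apply: (dust_f_quad two_neq0 l0 fG); apply: IH dust _; first exact: f_quad_neq0.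
  exact: free_f_quad.
apply: nfree; elim: n lambda lambda_neq0 fG => [//|n IH] l l0 fG.
by rewrite iterSr; apply: IH; [exact: f_quad_neq0 | exact: free_f_quad].
Qed.
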